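(* Let $f:[a,b]\to\mathbb{C}$ be a Lebesgue integrable function and let $M\ge 1\ge m\ge 0$. Suppose that $$\operatorname{Re}\left[\big(Mf(s)-f(t)\big)\big(\overline{f(t)}-m\overline{f(s)}\big)\right]\ge 0\quad\text{for a.e. } a\le t\le s\le b.$$ Then the following inequalities hold: $$\left(\int_a^b|f(t)|\,dt\right)^2 \le \left|\int_a^b f(t)\,dt\right|^2 + \frac12\cdot\frac{(M-m)^2}{M+m}\int_a^b (s-a)|f(s)|^2\,ds,$$ $$\int_a^b|f(t)|\,dt \le \left(\frac{M+m}{2\sqrt{Mm}}\right)^{1/2}\left|\int_a^b f(t)\,dt\right|,$$ and $$\int_a^b\big[(b-s)+mM(s-a)\big]|f(s)|^2\,ds \le \frac{M+m}{2}\left|\int_a^b f(s)\,ds\right|^2.$$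
   Context: Here $[a,b]$ is a compact real interval, $M$ and $m$ are real numbers, and ''for a.e. $a\le t\le s\le b$'' means for almost every $(t,s)$ in the triangle $\{(t,s)\in\mathbb{R}^2: a\le t\le s\le b\}$. *)

(* Defs.v *)
From HB Require Import structures.
From mathcomp Require Import all_boot all_order all_algebra.
From mathcomp Require Import all_classical all_reals all_analysis.
From mathcomp.real_closed Require Export complex.

Set Implicit Arguments.
Unset Strict Implicit.
Unset Printing Implicit Defensive.
Import Order.TTheory GRing.Theory Num.Theory.
Local Open Scope classical_set_scope.
Local Open Scope ring_scope.

Notation normc := ComplexField.Normc.normc.

Section ComplexLebesgueIntegral.
Context d (T : measurableType d) (R : realType).
Variables (mu : {measure set T -> \bar R}) (D : set T) (f : T -> R[i]).

Definition cintegrable : Prop :=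
  mu.-integrable D (fun x => (complex.Re (f x))%:E) /\
  mu.-integrable D (fun x => (complex.Im (f x))%:E).

Definition cintegral : R[i] :=
  Complex (Rintegral mu D (fun x => complex.Re (f x)))
          (Rintegral mu D (fun x => complex.Im (f x))).

End ComplexLebesgueIntegral.

(* The completed measure is used so that measurability means Lebesgue, and not
   just Borel, measurability.  The null sets of its product with itself (as
   library negligible sets, i.e. subsets of measurable sets of measure 0) are
   exactly the Lebesgue-null subsets of the plane. *)
Notation lambda := (@completed_lebesgue_measure _).

(* Main.v *)
Require Import Defs.
From mathcomp Require Import all_boot all_order all_algebra.
From mathcomp Require Import all_classical all_reals all_analysis.
From mathcomp Require Import measurable_realfun measurable_fun_approximation.
From mathcomp Require Import ring lra.
Set Implicit Arguments.
Unset Strict Implicit.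
Unset Printing Implicit Defensive.
Import Order.TTheory GRing.Theory Num.Theory numFieldNormedType.Exports.
Local Open Scope classical_set_scope.
Local Open Scope ring_scope.

(** The hypothesis says that, for almost every (t, s) in the triangle
    a <= t <= s <= b,
      |f(t)|^2 + mM |f(s)|^2 <= (M + m) Re (f(t) conj (f(s))).
    Integrating it over the triangle gives the third inequality: by symmetry
    the right-hand side integrates to (M + m)/2 |int f|^2, and on the left
    Tonelli yields the weights b - t and s - a.  By completing the square, the
    hypothesis bounds 2 (|f(t)||f(s)| - Re (f(t) conj (f(s)))) by
    (M - m)^2 / (2 (M + m)) |f(s)|^2, and by AM-GM it bounds
    2 sqrt(Mm) |f(t)||f(s)| by (M + m) Re (f(t) conj (f(s))); integrated over
    the triangle, these are the first and the second inequality.  For m = 0 the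
    constant of the second one is +oo, which is only a problem if int f = 0;
    then the third inequality forces f = 0 almost everywhere. *)

(** [L] need not be nonnegative everywhere, but 0 <= [K] <= [L] makes it so almost everywhere. It
    may thus be replaced by its absolute value, and monotonicity for nonnegative functions
    applies. *)
Lemma ge0_ae_le_integral_integrable d (T : measurableType d) (R : realType)
    (mu : {measure set T -> \bar R}) (D : set T) (K L : T -> R) :
  measurable D -> measurable_fun D K -> (forall x, D x -> 0 <= K x) ->
  mu.-integrable D (EFin \o L) ->
  {ae mu, forall x, D x -> K x <= L x} ->
  (\int[mu]_(x in D) (K x)%:E <= \int[mu]_(x in D) (L x)%:E)%E.
Proof.
move=> mD mK K0 iL KL.
have mL : measurable_fun D L by exact/measurable_EFinP/(measurable_int _ iL).
have -> : (\int[mu]_(x in D) (L x)%:E = \int[mu]_(x in D) `|L x|%:E)%E.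
  apply: ae_eq_integral => //; first exact/measurable_EFinP.
    by apply/measurable_EFinP; exact: measurableT_comp.
  apply: filterS KL => x KL Dx; congr EFin.
  by rewrite ger0_norm// (le_trans (K0 _ Dx))// KL.
apply: ae_ge0_le_integral => //.
- exact/measurable_EFinP.
- by apply/measurable_EFinP; exact: measurableT_comp.
- apply: filterS KL => x KL Dx; rewrite lee_fin.
  by rewrite (le_trans (KL Dx))// ler_norm.
Qed.

(** * Fubini and Tonelli on subsets of a product square *)

Section product_square.
Context d (T : measurableType d) (R : realType).
Variable mu : {sigma_finite_measure set T -> \bar R}.

(** Swapping the coordinates exchanges the two iterated integrals, which agree by Fubini. *)
Lemma integral_prod_swap (phi : T * T -> \bar R) :
  (mu \x mu)%E.-integrable setT phi ->
  (mu \x mu)%E.-integrable setT (fun p => phi (p.2, p.1)) /\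
  (\int[(mu \x mu)%E]_p phi (p.2, p.1) = \int[(mu \x mu)%E]_p phi p)%E.
Proof.
move=> iphi.
have mphi : measurable_fun setT phi by exact: measurable_int iphi.
have mpsi : measurable_fun setT (fun p : T * T => phi (p.2, p.1)).
  by apply: (measurableT_comp mphi); exact: measurable_swap.
have ipsi : (mu \x mu)%E.-integrable setT (fun p : T * T => phi (p.2, p.1)).
  by apply/integrable12ltyP => //; apply/(integrable21ltyP mu mu mphi).
split=> //.
by rewrite -integral12_prod_meas1// -(integral21_prod_meas1 iphi).
Qed.

(** The iterated integral of |h(x)||h(y)| factors and is finite, which gives integrability; then
    Fubini factors the signed integral in the same way. *)
Lemma integrable_tensor_square (h : T -> R) :
  mu.-integrable setT (EFin \o h) ->
  (mu \x mu)%E.-integrable setT (fun p => (h p.1 * h p.2)%:E) /\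
  (\int[(mu \x mu)%E]_p (h p.1 * h p.2)%:E = (\int[mu]_x (h x)%:E) ^+ 2)%E.
Proof.
move=> ih.
have mh : measurable_fun setT h by exact/measurable_EFinP/(measurable_int _ ih).
have mphi : measurable_fun setT (fun p : T * T => (h p.1 * h p.2)%:E).
  apply/measurable_EFinP; apply: measurable_funM.
  - exact: measurableT_comp.
  - exact: measurableT_comp.
have iphi : (mu \x mu)%E.-integrable setT (fun p : T * T => (h p.1 * h p.2)%:E).
  apply/integrable12ltyP => //.
  under eq_integral => x _.
    under eq_integral => y _ do rewrite /= normrM EFinM.
    rewrite ge0_integralZl//; last first.
      by apply/measurable_EFinP; exact: measurableT_comp.
    over.
  have /integrableP[_ hoo] := ih.
  rewrite ge0_integralZr//.
  - by rewrite lte_mul_pinfty ?integral_ge0// ge0_fin_numE// integral_ge0.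
  - by apply/measurable_EFinP; exact: measurableT_comp.
  - by apply: integral_ge0 => y _; rewrite lee_fin.
split=> //.
rewrite -integral12_prod_meas1// /fubini_F.
under eq_integral => x _.
  under eq_integral => y _ do rewrite /= EFinM.
  rewrite integralZl//.
  over.
have /fineK E := integrable_fin_num measurableT ih.
rewrite -E integralZr//; set c := fine _ in E *.
by rewrite -[X in (X * _)%E]/(\int[mu]_x (EFin \o h) x)%E -E.
Qed.

(** Up to a null set, [A] and its mirror image partition the square of [D]. The integrand is
    symmetric, so each half carries half of the integral. *)
Lemma integral_half_square (D : set T) (A : set (T * T)) (h : T -> R) :
  measurable D -> measurable A -> A `<=` D `*` D ->
  {ae (mu \x mu)%E, forall p, D p.1 -> D p.2 -> A p <-> ~ A (p.2, p.1)} ->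
  mu.-integrable D (EFin \o h) ->
  (mu \x mu)%E.-integrable A (fun p => (h p.1 * h p.2)%:E) /\
  (\int[(mu \x mu)%E]_(p in A) (h p.1 * h p.2)%:E =
    (2^-1)%:E * (\int[mu]_(x in D) (h x)%:E) ^+ 2)%E.
Proof.
move=> mD mA AD Ahalf ih.
pose H := h \_ D.
have iH : mu.-integrable setT (EFin \o H).
  by rewrite -restrict_EFin; apply/(integrable_mkcond _ mD).
have [iHH intHH] := integrable_tensor_square iH.
have AHE p : A p -> ((H p.1 * H p.2)%:E = (h p.1 * h p.2)%:E :> \bar R)%E.
  by move=> /AD[D1 D2]; rewrite /H !patchE !mem_set.
have iA : (mu \x mu)%E.-integrable A (fun p => (h p.1 * h p.2)%:E).
  apply: (eq_integrable mA (fun p => (H p.1 * H p.2)%:E)).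
    by move=> p /set_mem /AHE.
  exact: integrableS iHH.
split=> //.
pose phi := (fun p : T * T => (h p.1 * h p.2)%:E) \_ A.
have iphi : (mu \x mu)%E.-integrable setT phi.
  exact/(integrable_mkcond _ mA).
have [ipsi intpsi] := integral_prod_swap iphi.
have -> : (\int[mu]_(x in D) (h x)%:E = \int[mu]_x (H x)%:E)%E.
  by rewrite integral_mkcond; apply: eq_integral => x _; rewrite restrict_EFin.
rewrite -intHH.
(* Almost everywhere exactly one of the two summands is nonzero-extended from its half: [phi] lives
   on [A], the swapped [phi] on the mirror image. *)
have -> : (\int[(mu \x mu)%E]_p (H p.1 * H p.2)%:E =
  \int[(mu \x mu)%E]_p (phi p + phi (p.2, p.1)))%E.
  apply: ae_eq_integral => //.
  - exact: measurable_int iHH.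
  - apply: emeasurable_funD; [exact: measurable_int iphi|].
    exact: measurable_int ipsi.
  - apply: filterS Ahalf => -[x y] /= Axy _.
    rewrite /phi !patchE.
    case: ifPn => [/set_mem Ap|/negP Ap].
      have [Dx Dy] := AD _ Ap.
      rewrite memNset; last by apply/(Axy Dx Dy).
      by rewrite adde0; exact: (AHE _ Ap).
    case: ifPn => [/set_mem Aq|/negP Aq].
      by rewrite add0e -(AHE _ Aq) /= mulrC.
    rewrite adde0.
    case: (pselect (D x)) => [Dx|nDx]; last first.
      by rewrite /H patchE memNset// mul0r.
    case: (pselect (D y)) => [Dy|nDy]; last first.
      by rewrite [H y]patchE memNset// mulr0.
    exfalso; apply/Ap/mem_set/(Axy Dx Dy) => Aq'; exact/Aq/mem_set.
rewrite integralD// intpsi [in LHS]integral_mkcond.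
have /fineK <- := integrable_fin_num measurableT iphi.
by rewrite -EFinD -EFinM; congr EFin; field.
Qed.

(** Tonelli, with the indicator of [A] as a factor: [G] is constant in the inner integral, which
    leaves the measure of the section. *)
Lemma integral_section_fst (D : set T) (A : set (T * T)) (G : T -> R) :
  measurable D -> measurable A -> A `<=` D `*` D ->
  measurable_fun D G -> (forall x, D x -> 0 <= G x) ->
  (\int[(mu \x mu)%E]_(p in A) (G p.1)%:E =
   \int[mu]_(x in D) ((G x)%:E * mu (xsection A x)))%E.
Proof.
move=> mD mA AD mG G0.
pose H := G \_ D.
have mH : measurable_fun setT H by exact/(measurable_restrictT _ mD).
have H0 x : 0 <= H x by rewrite /H patchE; case: ifPn => // /set_mem /G0.
have -> : (\int[(mu \x mu)%E]_(p in A) (G p.1)%:E =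
   \int[(mu \x mu)%E]_p ((H p.1)%:E * (\1_A p)%:E))%E.
  rewrite integral_mkcond; apply: eq_integral => p _.
  rewrite patchE indicE; case: ifPn => [/set_mem/AD[D1 _]|_].
    by rewrite /H patchE mem_set// mule1.
  by rewrite mule0.
rewrite fubini_tonelli1//=; last 2 first.
- apply: emeasurable_funM; first by apply/measurable_EFinP; exact: measurableT_comp.
  by apply/measurable_EFinP; exact: measurable_indic.
- by move=> p; rewrite mule_ge0// lee_fin.
rewrite [RHS]integral_mkcond; apply: eq_integral => x _.
rewrite /fubini_F/= ge0_integralZl//; last 2 first.
- apply/measurable_EFinP; apply: measurableT_comp; first exact: measurable_indic.
  exact: pair1_measurable.
- by rewrite lee_fin.
rewrite patchE /H patchE; case: ifPn => [_|]; last by rewrite mul0e.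
congr (_ * _)%E.
under eq_integral => y _.
  rewrite (_ : \1_A (x, y) = \1_(xsection A x) y); last first.
    by rewrite !indicE mem_xsection.
  over.
by rewrite integral_indic ?setIT//; exact: measurable_xsection.
Qed.

(** The mirror case, with the first coordinate integrated first. *)
Lemma integral_section_snd (D : set T) (A : set (T * T)) (G : T -> R) :
  measurable D -> measurable A -> A `<=` D `*` D ->
  measurable_fun D G -> (forall x, D x -> 0 <= G x) ->
  (\int[(mu \x mu)%E]_(p in A) (G p.2)%:E =
   \int[mu]_(x in D) ((G x)%:E * mu (ysection A x)))%E.
Proof.
move=> mD mA AD mG G0.
pose H := G \_ D.
have mH : measurable_fun setT H by exact/(measurable_restrictT _ mD).
have H0 x : 0 <= H x by rewrite /H patchE; case: ifPn => // /set_mem /G0.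
have -> : (\int[(mu \x mu)%E]_(p in A) (G p.2)%:E =
   \int[(mu \x mu)%E]_p ((H p.2)%:E * (\1_A p)%:E))%E.
  rewrite integral_mkcond; apply: eq_integral => p _.
  rewrite patchE indicE; case: ifPn => [/set_mem/AD[_ D2]|_].
    by rewrite /H patchE mem_set// mule1.
  by rewrite mule0.
rewrite fubini_tonelli2//=; last 2 first.
- apply: emeasurable_funM; first by apply/measurable_EFinP; exact: measurableT_comp.
  by apply/measurable_EFinP; exact: measurable_indic.
- by move=> p; rewrite mule_ge0// lee_fin.
rewrite [RHS]integral_mkcond; apply: eq_integral => x _.
rewrite /fubini_G/= ge0_integralZl//; last 2 first.
- apply/measurable_EFinP; apply: measurableT_comp; first exact: measurable_indic.
  exact: pair2_measurable.
- by rewrite lee_fin.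
rewrite patchE /H patchE; case: ifPn => [_|]; last by rewrite mul0e.
congr (_ * _)%E.
under eq_integral => y _.
  rewrite (_ : \1_A (y, x) = \1_(ysection A x) y); last first.
    by rewrite !indicE mem_ysection.
  over.
by rewrite integral_indic ?setIT//; exact: measurable_ysection.
Qed.

End product_square.

(* [R] as the carrier of [lambda], with the Lebesgue instead of the Borel sets. *)
Notation lebesgue_type R := (caratheodory_type (@wlength R idfun)^*%mu).

(** * Lebesgue sets, closed intervals and the triangle *)

Lemma measurable_borel_lebesgue (R : realType) (A : set R) :
  measurable A -> measurable (A : set (lebesgue_type R)).
Proof. by move=> mA; apply: sub_caratheodory. Qed.

(** The domain carries the Lebesgue sets and the codomain the Borel sets. *)
Lemma measurable_id_lebesgue (R : realType) :
  measurable_fun [set: lebesgue_type R] (fun x : lebesgue_type R => x : R).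
Proof.
by move=> _ B mB; rewrite setTI; exact: measurable_borel_lebesgue.
Qed.

Lemma lambda_itvcc (R : realType) (x y : R) : x <= y ->
  lambda `[x, y]%classic = (y - x)%:E.
Proof.
move=> xy; rewrite -[LHS]/(lebesgue_measure `[x, y]%classic).
rewrite lebesgue_measure_itv/= lte_fin; case: ltP => // yx.
by rewrite (@le_anti _ _ x y) ?xy// subrr.
Qed.

Lemma lambda_set1 (R : realType) (x : R) : lambda [set x] = 0%E.
Proof. by rewrite -set_itv1 lambda_itvcc// subrr. Qed.

Section triangle.
Context (R : realType) (a b : R).

(** The first coordinate is t, the second is s. *)
Definition triangle : set (lebesgue_type R * lebesgue_type R) :=
  [set p | (a <= (p.1 : R)) /\ ((p.1 : R) <= p.2) /\ ((p.2 : R) <= b)].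

Lemma measurable_proj1 : measurable_fun setT
  (fun p : lebesgue_type R * lebesgue_type R => p.1 : R).
Proof. exact: (measurableT_comp (@measurable_id_lebesgue R)). Qed.

Lemma measurable_proj2 : measurable_fun setT
  (fun p : lebesgue_type R * lebesgue_type R => p.2 : R).
Proof. exact: (measurableT_comp (@measurable_id_lebesgue R)). Qed.

Lemma measurable_triangle : measurable triangle.
Proof.
have -> : triangle = [set p : lebesgue_type R * lebesgue_type R | a <= (p.1 : R)] `&`
  ([set p : lebesgue_type R * lebesgue_type R | (p.1 : R) <= p.2] `&`
   [set p : lebesgue_type R * lebesgue_type R | (p.2 : R) <= b]) by [].
have m1 := measurable_proj1; have m2 := measurable_proj2.
apply: measurableI; [|apply: measurableI];
  rewrite -[X in measurable X]setTI; exact: measurable_fun_le.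
Qed.

Lemma triangle_sub : triangle `<=` `[a, b] `*` `[a, b].
Proof.
move=> [x y] /= [ax [xy yb]]; rewrite !in_itv/=.
by rewrite ax yb (le_trans xy yb) (le_trans ax xy).
Qed.

Lemma xsection_triangle (x : R) : a <= x -> xsection triangle x = `[x, b]%classic.
Proof.
move=> ax; apply/seteqP; split=> y; rewrite /xsection/= inE /= in_itv/=.
  by move=> [_ [-> ->]].
by move=> /andP[xy yb].
Qed.

Lemma ysection_triangle (y : R) : y <= b -> ysection triangle y = `[a, y]%classic.
Proof.
move=> yb; apply/seteqP; split=> x; rewrite /ysection/= inE /= in_itv/=.
  by move=> [-> [-> _]].
by move=> /andP[ax xy].
Qed.

(** Only the diagonal is exceptional, and its sections are single points. This makes the triangle a
    half of the square as [integral_half_square] requires. *)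
Lemma ae_triangle_half : {ae (lambda \x lambda)%E,
  forall p : lebesgue_type R * lebesgue_type R,
   `[a, b]%classic p.1 -> `[a, b]%classic p.2 ->
   triangle p <-> ~ triangle (p.2, p.1)}.
Proof.
exists [set p : lebesgue_type R * lebesgue_type R | (p.1 : R) == p.2]; split.
- rewrite -[X in measurable X]setTI.
  apply: measurable_fun_eqr => //; first exact: measurable_proj1.
  exact: measurable_proj2.
- apply: integral0_eq => x _ /=.
  rewrite (_ : xsection _ _ = [set x]) ?lambda_set1//.
  apply/seteqP; split=> y; rewrite /xsection/= inE /=.
    by move=> /eqP ->.
  by move=> ->.
- move=> [x y] /= /not_implyP[]; rewrite !in_itv/= => /andP[ax xb].
  move=> /not_implyP[/andP[ay yb]] xy.
  apply: contrapT => /negP nxy; apply: xy; rewrite /triangle/=.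
  case: (ltgtP x y) nxy => // xy _; split.
  + by move=> _ [_ []].
  + by [].
  + by move=> [_ []].
  + by move=> nA; exfalso; exact: nA.
Qed.

(** The section of the triangle at t is [t, b], of length b - t. *)
Lemma integral_triangle_fst (G : lebesgue_type R -> R) :
  measurable_fun (`[a, b]%classic : set (lebesgue_type R)) G ->
  (forall x, `[a, b]%classic x -> 0 <= G x) ->
  (\int[(lambda \x lambda)%E]_(p in triangle) (G p.1)%:E =
   \int[lambda]_(x in `[a, b]) ((b - x) * G x)%:E)%E.
Proof.
move=> mG G0.
have mD : measurable (`[a, b]%classic : set (lebesgue_type R)).
  exact: measurable_borel_lebesgue.
rewrite (@integral_section_fst _ (lebesgue_type R) R lambda _ _ _ mD
  measurable_triangle triangle_sub mG G0).
apply: eq_integral => x; rewrite inE/= in_itv/= => /andP[ax xb].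
by rewrite xsection_triangle// lambda_itvcc// -EFinM mulrC.
Qed.

(** The section at s is [a, s], of length s - a. *)
Lemma integral_triangle_snd (G : lebesgue_type R -> R) :
  measurable_fun (`[a, b]%classic : set (lebesgue_type R)) G ->
  (forall x, `[a, b]%classic x -> 0 <= G x) ->
  (\int[(lambda \x lambda)%E]_(p in triangle) (G p.2)%:E =
   \int[lambda]_(x in `[a, b]) ((x - a) * G x)%:E)%E.
Proof.
move=> mG G0.
have mD : measurable (`[a, b]%classic : set (lebesgue_type R)).
  exact: measurable_borel_lebesgue.
rewrite (@integral_section_snd _ (lebesgue_type R) R lambda _ _ _ mD
  measurable_triangle triangle_sub mG G0).
apply: eq_integral => x; rewrite inE/= in_itv/= => /andP[ax xb].
by rewrite ysection_triangle// lambda_itvcc// -EFinM mulrC.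
Qed.

End triangle.

(** * Pointwise identities and inequalities *)

Lemma Re_mul_conj_sub (R : rcfType) (M m : R) (z w : R[i]) :
  complex.Re ((M%:C%C * w - z) * (z^*%C - m%:C%C * w^*%C)) =
  (M + m) * (complex.Re z * complex.Re w + complex.Im z * complex.Im w)
  - (normc z ^+ 2 + m * M * normc w ^+ 2).
Proof.
case: z w => [x1 y1] [x2 y2] /=.
rewrite !sqr_sqrtr ?addr_ge0 ?sqr_ge0//; ring.
Qed.

Lemma Re_le_normc (R : rcfType) (z w : R[i]) :
  complex.Re z * complex.Re w + complex.Im z * complex.Im w <= normc z * normc w.
Proof.
case: z w => [x1 y1] [x2 y2] /=.
rewrite -sqrtrM ?addr_ge0 ?sqr_ge0//.
rewrite (le_trans (ler_norm _))// -sqrtr_sqr ler_wsqrtr//.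
(* Lagrange's identity: this square is the difference of the two sides under the roots. *)
have := sqr_ge0 (x1 * y2 - x2 * y1); nra.
Qed.

Lemma reverse_cauchy_schwarz_sub (R : realFieldType) (M m x y c : R) : 0 < M + m ->
  x ^+ 2 + m * M * y ^+ 2 <= (M + m) * c ->
  2 * (x * y - c) <= 2^-1 * ((M - m) ^+ 2 / (M + m)) * y ^+ 2.
Proof.
move=> Mm0 H.
have -> : 2^-1 * ((M - m) ^+ 2 / (M + m)) * y ^+ 2 =
  2^-1 * (M - m) ^+ 2 * y ^+ 2 / (M + m) by field; rewrite gt_eqF.
rewrite ler_pdivlMr//.
(* Completing the square in [x] leaves the coefficient (M + m)^2 - 4mM = (M - m)^2, up to a
   factor. *)
have := sqr_ge0 (x - (M + m) / 2 * y); nra.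
Qed.

Lemma reverse_cauchy_schwarz_mul (R : rcfType) (M m x y c : R) : 0 <= M * m ->
  x ^+ 2 + m * M * y ^+ 2 <= (M + m) * c ->
  2 * Num.sqrt (M * m) * (x * y) <= (M + m) * c.
Proof.
move=> Mm0; apply: le_trans; rewrite [m * M]mulrC -{2}(sqr_sqrtr Mm0).
(* AM-GM for [x] and sqrt(Mm) [y]. *)
have := sqr_ge0 (x - Num.sqrt (M * m) * y); nra.
Qed.

Lemma normcE (R : rcfType) (z : R[i]) :
  normc z = Num.sqrt (complex.Re z ^+ 2 + complex.Im z ^+ 2).
Proof. by case: z. Qed.

Lemma normc_ge0 (R : rcfType) (z : R[i]) : 0 <= normc z.
Proof. by rewrite normcE sqrtr_ge0. Qed.

Lemma sqr_normc (R : rcfType) (z : R[i]) :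
  normc z ^+ 2 = complex.Re z ^+ 2 + complex.Im z ^+ 2.
Proof. by rewrite normcE sqr_sqrtr// addr_ge0 ?sqr_ge0. Qed.

Lemma normc_le_add (R : rcfType) (z : R[i]) :
  normc z <= `|complex.Re z| + `|complex.Im z|.
Proof.
rewrite -(ler_sqr (normc_ge0 z)) ?nnegrE ?addr_ge0// sqr_normc.
rewrite sqrrD !real_normK ?num_real//.
by rewrite lerD2r lerDl mulrn_wge0// mulr_ge0.
Qed.

(** * Modulus and components of an integrable complex function *)

Section cintegrable_normc.
Context d (T : measurableType d) (R : realType).
Variables (mu : {measure set T -> \bar R}) (D : set T) (f : T -> R[i]).
Hypotheses (mD : measurable D) (fi : cintegrable mu D f).

Lemma cintegrable_measurable_normc : measurable_fun D (fun x => normc (f x)).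
Proof.
have [/(measurable_int mu)/measurable_EFinP mRe] := fi.
move=> /(measurable_int mu)/measurable_EFinP mIm.
under eq_fun do rewrite normcE.
apply: (@measurableT_comp _ _ _ _ _ _ (@Num.sqrt R)).
  by apply: continuous_measurable_fun; exact: sqrt_continuous.
by apply: measurable_funD; exact: measurable_funX.
Qed.

(** The modulus is dominated by |Re f| + |Im f|. *)
Lemma cintegrable_normc : mu.-integrable D (fun x => (normc (f x))%:E).
Proof.
have [iu iv] := fi.
apply: (le_integrable mD _ _ (integrableD mD (integrable_abse iu) (integrable_abse iv))).
  by apply/measurable_EFinP; exact: cintegrable_measurable_normc.
move=> x _ /=; rewrite lee_fin (ger0_norm (normc_ge0 _)).
by rewrite (le_trans (normc_le_add _))// ler_norm.
Qed.

(** Integrability makes the integral finite, so the [fine] inside [Rintegral] loses nothing. *)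
Lemma cintegralE_Re : (\int[mu]_(x in D) (complex.Re (f x))%:E =
  (complex.Re (cintegral mu D f))%:E)%E.
Proof. by rewrite /= /Rintegral fineK//; apply: integrable_fin_num => //; exact: fi.1. Qed.

Lemma cintegralE_Im : (\int[mu]_(x in D) (complex.Im (f x))%:E =
  (complex.Im (cintegral mu D f))%:E)%E.
Proof. by rewrite /= /Rintegral fineK//; apply: integrable_fin_num => //; exact: fi.2. Qed.

End cintegrable_normc.

Section half_square.
Context d (T : measurableType d) (R : realType).
Variable mu : {sigma_finite_measure set T -> \bar R}.
Variables (D : set T) (A : set (T * T)) (f : T -> R[i]).
Hypotheses (mD : measurable D) (mA : measurable A) (AD : A `<=` D `*` D).
Hypothesis Ahalf :
  {ae (mu \x mu)%E, forall p, D p.1 -> D p.2 -> A p <-> ~ A (p.2, p.1)}.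
Hypothesis fi : cintegrable mu D f.

(** This is Re (f(t) conj (f(s))) for p = (t, s). *)
Let C p := complex.Re (f p.1) * complex.Re (f p.2)
         + complex.Im (f p.1) * complex.Im (f p.2).

Lemma integrable_half_dot : (mu \x mu)%E.-integrable A (fun p => (C p)%:E).
Proof.
have [iu _] := integral_half_square mD mA AD Ahalf fi.1.
have [iv _] := integral_half_square mD mA AD Ahalf fi.2.
exact: (integrableD mA iu iv).
Qed.

(** The half-square formula for Re f and for Im f; the squares of the two integrals add up to |int
    f|^2. *)
Lemma integral_half_dot : (\int[(mu \x mu)%E]_(p in A) (C p)%:E =
  (2^-1 * normc (cintegral mu D f) ^+ 2)%:E)%E.
Proof.
have [iu intu] := integral_half_square mD mA AD Ahalf fi.1.
have [iv intv] := integral_half_square mD mA AD Ahalf fi.2.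
under eq_integral do rewrite EFinD.
rewrite (integralD mA iu iv) intu intv.
by rewrite cintegralE_Re// cintegralE_Im// -!EFin_expe -!EFinM -EFinD -mulrDr sqr_normc.
Qed.

End half_square.

(** * Integration of the pointwise inequalities over the triangle *)

Section triangle_inequalities.
Variables (R : realType) (a b M m : R) (f : lebesgue_type R -> R[i]).
Hypotheses (hM : 1 <= M) (hm0 : 0 <= m).
Let D : set (lebesgue_type R) := `[a, b]%classic.
Hypothesis fi : cintegrable lambda D f.
Let C (p : lebesgue_type R * lebesgue_type R) :=
  complex.Re (f p.1) * complex.Re (f p.2)
         + complex.Im (f p.1) * complex.Im (f p.2).
Hypothesis hae : {ae (lambda \x lambda)%E,
  forall p : lebesgue_type R * lebesgue_type R, triangle a b p ->
    normc (f p.1) ^+ 2 + m * M * normc (f p.2) ^+ 2 <= (M + m) * C p}.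

Let Mm_gt0 : 0 < M + m. Proof. by rewrite ltr_wpDr// (lt_le_trans ltr01). Qed.
Let mM_ge0 : 0 <= m * M. Proof. by rewrite mulr_ge0// (le_trans ler01). Qed.

Let mD : measurable D. Proof. by rewrite /D; exact: measurable_borel_lebesgue. Qed.
Let mA : measurable (triangle a b). Proof. exact: measurable_triangle. Qed.

Let mr : measurable_fun D (fun x => normc (f x)).
Proof. exact: cintegrable_measurable_normc fi. Qed.
Let mr2 : measurable_fun D (fun x => normc (f x) ^+ 2).
Proof. exact: measurable_funX. Qed.

(** Measurability of [h] is known on [D] only, so the projection has to map the triangle into
    [D]. *)
Let mfst (h : lebesgue_type R -> R) : measurable_fun D h ->
  measurable_fun (triangle a b) (fun p => h p.1).
Proof.
move=> mh; apply: (measurable_comp mD) => //.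
  by move=> x [p /triangle_sub[] ? _ <-].
exact: measurable_funTS.
Qed.

Let msnd (h : lebesgue_type R -> R) : measurable_fun D h ->
  measurable_fun (triangle a b) (fun p => h p.2).
Proof.
move=> mh; apply: (measurable_comp mD) => //.
  by move=> x [p /triangle_sub[] _ ? <-].
exact: measurable_funTS.
Qed.

Let iC : (lambda \x lambda)%E.-integrable (triangle a b) (fun p => (C p)%:E).
Proof.
by apply: (integrable_half_dot mD mA _ _ fi);
  [exact: triangle_sub|exact: ae_triangle_half].
Qed.

Let intC : (\int[(lambda \x lambda)%E]_(p in triangle a b) (C p)%:E =
  (2^-1 * normc (cintegral lambda D f) ^+ 2)%:E)%E.
Proof.
by apply: (integral_half_dot mD mA _ _ fi);
  [exact: triangle_sub|exact: ae_triangle_half].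
Qed.

Let iCM : (lambda \x lambda)%E.-integrable (triangle a b)
  (EFin \o (fun p => (M + m) * C p)).
Proof.
rewrite (_ : _ \o _ = (fun p => (M + m)%:E * (C p)%:E)%E) //.
exact: integrableZl.
Qed.

Let intCM : (\int[(lambda \x lambda)%E]_(p in triangle a b) ((M + m) * C p)%:E =
  ((M + m) / 2 * normc (cintegral lambda D f) ^+ 2)%:E)%E.
Proof.
under eq_integral do rewrite EFinM.
by rewrite integralZl// intC -EFinM mulrA.
Qed.

Let N := fine (\int[lambda]_(t in D) (normc (f t))%:E)%E.

Let NE : (\int[lambda]_(t in D) (normc (f t))%:E)%E = N%:E.
Proof.
rewrite fineK//; apply: integrable_fin_num => //.
exact: cintegrable_normc.
Qed.

Let irr : (lambda \x lambda)%E.-integrable (triangle a b)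
  (fun p => (normc (f p.1) * normc (f p.2))%:E).
Proof.
exact: (integral_half_square mD mA (@triangle_sub _ a b) (ae_triangle_half a b)
  (cintegrable_normc mD fi)).1.
Qed.

Let intrr : (\int[(lambda \x lambda)%E]_(p in triangle a b)
  (normc (f p.1) * normc (f p.2))%:E = (2^-1 * N ^+ 2)%:E)%E.
Proof.
rewrite (integral_half_square mD mA (@triangle_sub _ a b) (ae_triangle_half a b)
  (cintegrable_normc mD fi)).2 NE -EFin_expe.
by rewrite -EFinM.
Qed.

Let Db (x : R) : D x -> 0 <= b - x.
Proof. by rewrite /D/= in_itv/= subr_ge0 => /andP[]. Qed.

Let Da (x : R) : D x -> 0 <= x - a.
Proof. by rewrite /D/= in_itv/= subr_ge0 => /andP[]. Qed.

Let mid : measurable_fun D (fun x => x : R).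
Proof. exact: measurable_funTS (@measurable_id_lebesgue R). Qed.

Let mb : measurable_fun D (fun x : lebesgue_type R => b - x).
Proof. exact: (measurable_funB (measurable_cst b) mid). Qed.

Let ma : measurable_fun D (fun x : lebesgue_type R => x - a).
Proof. exact: (measurable_funB mid (measurable_cst a)). Qed.

(** Since f is only assumed integrable, the left side is an integral in [0, +oo], treated by
    Tonelli; its finiteness is part of the conclusion. *)
Lemma weighted_norm_sqr_le :
  (\int[lambda]_(s in D)
     (((b - s) + m * M * (s - a)) * normc (f s) ^+ 2)%:E
   <= ((M + m) / 2 * normc (cintegral lambda D f) ^+ 2)%:E)%E.
Proof.
rewrite -intCM.
have mr2m : measurable_fun D (fun x => m * M * normc (f x) ^+ 2).
  exact: (measurable_funM (measurable_cst _) mr2).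
have r2m_ge0 x : 0 <= m * M * normc (f x) ^+ 2 by rewrite mulr_ge0// sqr_ge0.
(* The weights b - s and s - a are lengths of sections, so the left side is itself an integral over
   the triangle. *)
have -> : (\int[lambda]_(s in D)
     (((b - s) + m * M * (s - a)) * normc (f s) ^+ 2)%:E =
  \int[(lambda \x lambda)%E]_(p in triangle a b)
     (normc (f p.1) ^+ 2 + m * M * normc (f p.2) ^+ 2)%:E)%E.
  under [RHS]eq_integral do rewrite EFinD.
  rewrite (ge0_integralD _ mA); last 4 first.
  - by move=> p _; rewrite lee_fin sqr_ge0.
  - by apply/measurable_EFinP; exact: (mfst mr2).
  - by move=> p _; rewrite lee_fin; exact: r2m_ge0.
  - by apply/measurable_EFinP; exact: (msnd mr2m).
  rewrite (integral_triangle_fst mr2); last by move=> x _; exact: sqr_ge0.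
  rewrite (integral_triangle_snd mr2m); last by move=> x _; exact: r2m_ge0.
  rewrite -(ge0_integralD _ mD); last 4 first.
  - by move=> x Dx; rewrite lee_fin mulr_ge0 ?sqr_ge0 ?Db.
  - by apply/measurable_EFinP; exact: (measurable_funM mb mr2).
  - by move=> x Dx; rewrite lee_fin mulr_ge0 ?Da ?r2m_ge0.
  - by apply/measurable_EFinP; exact: (measurable_funM ma mr2m).
  by apply: eq_integral => x _; rewrite -EFinD; congr EFin; ring.
apply: (ge0_ae_le_integral_integrable mA _ _ iCM hae).
- exact: (measurable_funD (mfst mr2) (msnd mr2m)).
- by move=> p _; rewrite addr_ge0 ?sqr_ge0 ?r2m_ge0.
Qed.

Lemma sqr_norm_integral_le :
  ((\int[lambda]_(t in D) (normc (f t))%:E) ^+ 2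
     <= (normc (cintegral lambda D f) ^+ 2)%:E
        + (2^-1 * ((M - m) ^+ 2 / (M + m)))%:E
          * \int[lambda]_(s in D) ((s - a) * normc (f s) ^+ 2)%:E)%E.
Proof.
set d := 2^-1 * _.
have d0 : 0 <= d by rewrite mulr_ge0// divr_ge0 ?sqr_ge0// ltW.
have mr2d : measurable_fun D (fun x => d * normc (f x) ^+ 2).
  exact: (measurable_funM (measurable_cst _) mr2).
have mC : measurable_fun (triangle a b) C.
  by apply/measurable_EFinP; exact: measurable_int iC.
have -> : (d%:E * \int[lambda]_(s in D) ((s - a) * normc (f s) ^+ 2)%:E =
    \int[(lambda \x lambda)%E]_(p in triangle a b) (d * normc (f p.2) ^+ 2)%:E)%E.
  rewrite (integral_triangle_snd mr2d); last first.
    by move=> x _; rewrite mulr_ge0// sqr_ge0.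
  rewrite -(ge0_integralZl lambda mD); last 3 first.
  - by apply/measurable_EFinP; exact: (measurable_funM ma mr2).
  - by move=> x Dx; rewrite lee_fin mulr_ge0 ?sqr_ge0 ?Da.
  - by rewrite lee_fin.
  by apply: eq_integral => x _; rewrite -EFinM; congr EFin; ring.
(* The finite term |int f|^2 moves to the left; the remaining integral on the right may be
   infinite. *)
rewrite NE -EFin_expe addeC -leeBlDr//.
have -> : ((N ^+ 2)%:E - (normc (cintegral lambda D f) ^+ 2)%:E =
    \int[(lambda \x lambda)%E]_(p in triangle a b)
    (2 * (normc (f p.1) * normc (f p.2) - C p))%:E)%E.
  under eq_integral do rewrite EFinM EFinB.
  rewrite (integralZl mA (integrableB mA irr iC)) (integralB mA irr iC) intrr intC.
  by rewrite -!EFinB -EFinM; congr EFin; field.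
(* The left integrand is nonnegative by Cauchy-Schwarz, so monotonicity does not require a finite
   right side. *)
apply: (ae_ge0_le_integral mA).
- by move=> p _; rewrite lee_fin mulr_ge0// subr_ge0; exact: Re_le_normc.
- apply/measurable_EFinP; apply: (measurable_funM (measurable_cst _)).
  exact: (measurable_funB (measurable_funM (mfst mr) (msnd mr)) mC).
- by move=> p _; rewrite lee_fin mulr_ge0// sqr_ge0.
- by apply/measurable_EFinP; exact: (msnd mr2d).
- apply: filterS hae => p hp Ap; rewrite lee_fin.
  by apply: reverse_cauchy_schwarz_sub => //; exact: hp.
Qed.

(** The second inequality, squared and multiplied by sqrt(Mm), a form without division that makes
    sense for m = 0. *)
Lemma norm_integral_le_real :
  Num.sqrt (M * m) * N ^+ 2 <= (M + m) / 2 * normc (cintegral lambda D f) ^+ 2.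
Proof.
set s := Num.sqrt _.
have s0 : 0 <= s by exact: sqrtr_ge0.
rewrite -lee_fin -intCM.
have -> : ((s * N ^+ 2)%:E = \int[(lambda \x lambda)%E]_(p in triangle a b)
    (2 * s * (normc (f p.1) * normc (f p.2)))%:E)%E.
  under eq_integral do rewrite EFinM.
  by rewrite (integralZl mA irr) intrr -EFinM; congr EFin; field.
apply: (ge0_ae_le_integral_integrable mA _ _ iCM).
- apply: (measurable_funM (measurable_cst _)).
  exact: (measurable_funM (mfst mr) (msnd mr)).
- by move=> p _; rewrite !mulr_ge0 ?normc_ge0.
- apply: filterS hae => p hp Ap.
  by apply: reverse_cauchy_schwarz_mul; [rewrite mulrC|exact: hp].
Qed.

(** The third inequality forces the weighted integral of |f|^2 to vanish, and its weight is positive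
    on [a, b). *)
Lemma integral_norm_eq0 : normc (cintegral lambda D f) = 0 -> N = 0.
Proof.
move=> I0; have := weighted_norm_sqr_le; rewrite I0 expr0n mulr0.
have w0 x : D x -> (0 <= (((b - x) + m * M * (x - a)) * normc (f x) ^+ 2)%:E)%E.
  by move=> Dx; rewrite lee_fin mulr_ge0 ?sqr_ge0// addr_ge0 ?Db// mulr_ge0 ?Da.
have mw : measurable_fun D (fun s : lebesgue_type R =>
    (((b - s) + m * M * (s - a)) * normc (f s) ^+ 2)%:E).
  apply/measurable_EFinP; apply: measurable_funM mr2.
  exact: (measurable_funD mb (measurable_funM (measurable_cst _) ma)).
move=> le0.
have : (\int[lambda]_(x in D)
    `|(((b - x) + m * M * (x - a)) * normc (f x) ^+ 2)%:E| = 0)%E.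
  apply/eqP; rewrite eq_le; apply/andP; split.
    rewrite (le_trans _ le0)// le_eqVlt; apply/orP; left; apply/eqP.
    by apply: eq_integral => x /set_mem Dx; rewrite gee0_abs ?w0.
  by apply: integral_ge0.
move/(ae_eq_integral_abs lambda mD mw) => ae0.
rewrite /N (ae_eq_integral (cst 0%E) _ mD); last 3 first.
- exact/measurable_EFinP.
- exact: measurable_cst.
(* At [b] the weight is mM(b - a), which may be 0; this point is discarded as a null set. *)
- have b0 : {ae lambda, forall x : lebesgue_type R, (x : R) != b}.
    exists [set (b : lebesgue_type R)]; split.
    - exact: measurable_borel_lebesgue.
    - exact: lambda_set1.
    - by move=> x /= /negP; rewrite negbK => /eqP.
  apply: filterS2 ae0 b0 => x /= + xb Dx => /(_ Dx)[] /eqP.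
  rewrite mulf_eq0 sqrf_eq0 => /orP[|/eqP -> //].
  have bx : 0 < b - x by rewrite lt_neqAle Db// andbT eq_sym subr_eq0 eq_sym.
  by rewrite gt_eqF// (lt_le_trans bx)// lerDl mulr_ge0 ?Da.
by rewrite integral0.
Qed.

Lemma norm_integral_le :
  (\int[lambda]_(t in D) (normc (f t))%:E
     <= ((M + m)%:E / (2 * Num.sqrt (M * m))%:E) `^ 2^-1
        * (normc (cintegral lambda D f))%:E)%E.
Proof.
have I0 := normc_ge0 (cintegral lambda D f).
have N0 : 0 <= N.
  by apply: fine_ge0; apply: integral_ge0 => x _; rewrite lee_fin normc_ge0.
rewrite NE.
(* Here both sides are 0, even for an infinite constant, as +oo * 0 = 0. *)
have [Iz|Inz] := eqVneq (normc (cintegral lambda D f)) 0.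
  by rewrite (integral_norm_eq0 Iz) Iz mule0.
(* The extended inverse of 0 is +oo, so the constant is +oo and so is its product with |int f| >
   0. *)
have [sz|snz] := eqVneq (Num.sqrt (M * m)) 0.
  rewrite sz mulr0 inve0 gt0_muley ?lte_fin// poweRyr ?invr_eq0//.
  by rewrite gt0_mulye ?leey// lte_fin lt_neqAle eq_sym Inz.
have s0 : 0 < Num.sqrt (M * m) by rewrite lt_neqAle eq_sym snz sqrtr_ge0.
rewrite inver ifF; last by apply/negbTE; rewrite mulf_neq0.
have c0 : 0 <= (M + m) / (2 * Num.sqrt (M * m)).
  by rewrite divr_ge0 ?mulr_ge0// ltW.
rewrite -EFinM lee_fin powR12_sqrt//.
(* Squaring and multiplying by sqrt(Mm) > 0 reduces the claim to [norm_integral_le_real]. *)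
rewrite -ler_sqr ?nnegrE ?mulr_ge0// exprMn sqr_sqrtr//.
rewrite -(ler_pM2l s0) (le_trans norm_integral_le_real)//.
rewrite le_eqVlt; apply/orP; left; apply/eqP; field.
by rewrite gt_eqF.
Qed.

End triangle_inequalities.

Theorem proposition1 (R : realType) (a b M m : R) (f : R -> R[i])
  (hab : a <= b) (hM : 1 <= M) (hm1 : m <= 1) (hm0 : 0 <= m)
  (hf : cintegrable lambda `[a, b] f)
  (hae : {ae (lambda \x lambda)%E, forall p : R * R,
     a <= p.1 -> p.1 <= p.2 -> p.2 <= b ->
     0 <= complex.Re ((M%:C%C * f p.2 - f p.1) *
              ((f p.1)^*%C - m%:C%C * (f p.2)^*%C))}) :
  [/\ ((\int[lambda]_(t in `[a, b]) (normc (f t))%:E) ^+ 2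
        <= (normc (cintegral lambda `[a, b] f) ^+ 2)%:E
           + (2^-1 * ((M - m) ^+ 2 / (M + m)))%:E
             * \int[lambda]_(s in `[a, b])
                  ((s - a) * normc (f s) ^+ 2)%:E)%E,
      (\int[lambda]_(t in `[a, b]) (normc (f t))%:E
        <= ((M + m)%:E / (2 * Num.sqrt (M * m))%:E) `^ 2^-1
           * (normc (cintegral lambda `[a, b] f))%:E)%E
    & (\int[lambda]_(s in `[a, b])
          (((b - s) + m * M * (s - a)) * normc (f s) ^+ 2)%:E
        <= ((M + m) / 2 * normc (cintegral lambda `[a, b] f) ^+ 2)%:E)%E].
Proof.
have hae' : {ae (lambda \x lambda)%E,
  forall p : lebesgue_type R * lebesgue_type R, triangle a b p ->
    normc (f p.1) ^+ 2 + m * M * normc (f p.2) ^+ 2 <= (M + m) *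
    (complex.Re (f p.1) * complex.Re (f p.2)
         + complex.Im (f p.1) * complex.Im (f p.2))}.
  (* The same null set serves, since the expanded product turns one condition into the other. *)
  have [B [mB B0 subB]] := hae; exists B; split=> //.
  apply: subset_trans subB; apply: subsetC => p /= hp [ap [pp pb]].
  by rewrite -subr_ge0 -Re_mul_conj_sub; exact: hp.
split.
- exact: (sqr_norm_integral_le hM hm0 hf hae').
- exact: (norm_integral_le hM hm0 hf hae').
- exact: (weighted_norm_sqr_le hM hm0 hf hae').
Qed.
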